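(* Any non-trivial 2-dimensional real commutative Jordan algebra is isomorphic to one and only one of the following algebras, listed by their matrices of structure constants: \[\begin{pmatrix}\frac12&0&0&1\\ 0&\frac12&\frac12&0\end{pmatrix},\quad \begin{pmatrix}\frac12&0&0&-1\\ 0&\frac12&\frac12&0\end{pmatrix},\quad \begin{pmatrix}\frac23&0&0&0\\ 0&\frac13&\frac13&0\end{pmatrix},\] \[\begin{pmatrix}\frac12&0&0&0\\ 0&\frac12&\frac12&0\end{pmatrix},\quad \begin{pmatrix}1&0&0&0\\ 0&0&0&0\end{pmatrix},\quad \begin{pmatrix}0&0&0&0\\ 1&0&0&0\end{pmatrix}.\]
   Context: A 2-dimensional real algebra is a 2-dimensional real vector space $\mathbb{A}$ with a bilinear multiplication $\cdot$ (not necessarily associative or unital); it is non-trivial if the multiplication is not identically zero. It is a commutative Jordan algebra if $\mathbf{u}\cdot\mathbf{v}=\mathbf{v}\cdot\mathbf{u}$ and $(\mathbf{u}\cdot\mathbf{v})\cdot\mathbf{u}^2=\mathbf{u}\cdot(\mathbf{v}\cdot\mathbf{u}^2)$ for all $\mathbf{u},\mathbf{v}\in\mathbb{A}$, where $\mathbf{u}^2=\mathbf{u}\cdot\mathbf{u}$. Given a basis $(e_1,e_2)$, the matrix of structure constants (MSC) of $\mathbb{A}$ is \[A=\begin{pmatrix}A^1_{1,1}&A^1_{1,2}&A^1_{2,1}&A^1_{2,2}\\ A^2_{1,1}&A^2_{1,2}&A^2_{2,1}&A^2_{2,2}\end{pmatrix},\qquad e_i\cdot e_j=A^1_{i,j}e_1+A^2_{i,j}e_2.\]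 Two algebras with MSCs $A$ and $B$ are isomorphic if and only if $B=gA(g^{-1}\otimes g^{-1})$ for some $g\in GL(2,\mathbb{R})$, where $\otimes$ is the Kronecker product. An algebra is identified with its MSC. *)

(* Defs.v *)
From mathcomp Require Import all_boot all_order all_algebra.
From mathcomp Require Import reals mxtens.

Set Implicit Arguments.
Unset Strict Implicit.
Unset Printing Implicit Defensive.

Import GRing.Theory.
Local Open Scope ring_scope.

Section Algebras.
Variable R : fieldType.

(* Algebras need be neither associative nor unital, so an algebra is a vector
   space V together with a bilinear map V -> V -> V. *)

Definition nontrivial_algebra (V : lmodType R) (mul : V -> V -> V) : Prop :=
  exists u v : V, mul u v != 0.

Definition commutative_jordan (V : lmodType R) (mul : V -> V -> V) : Prop :=
  (forall u v : V, mul u v = mul v u) /\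
  (forall u v : V,
     mul (mul u v) (mul u u) = mul u (mul v (mul u u))).

Definition algebra_isomorphic (V W : lmodType R)
    (mulV : V -> V -> V) (mulW : W -> W -> W) : Prop :=
  exists f : {linear V -> W},
    bijective f /\ forall u v : V, f (mulV u v) = mulW (f u) (f v).

(* The columns of a matrix of structure constants are indexed by 'I_(2 * 2) in
   the order (1,1), (1,2), (2,1), (2,2). The product it defines on coordinate
   vectors is u . v = A (u (x) v); by msc_mul_delta its structure constants in
   the canonical basis are the entries of A. *)
Definition msc_mul (A : 'M[R]_(2, 2 * 2)) (u v : 'cV[R]_2) : 'cV[R]_2 :=
  A *m (u *t v).

Lemma msc_mul_delta (A : 'M[R]_(2, 2 * 2)) (i j : 'I_2) :
  msc_mul A (delta_mx i 0) (delta_mx j 0) =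
  \sum_(k < 2) A k (mxtens_index (i, j)) *: delta_mx k 0.
Proof.
have tE m l : ((delta_mx i 0 : 'cV[R]_2) *t (delta_mx j 0 : 'cV[R]_2)) m l =
    (m == mxtens_index (i, j))%:R.
  case: (mxtens_indexP m) => i' j'; rewrite mxE mxtens_indexK /=.
  rewrite (can_eq (@mxtens_indexK 2 2)) xpair_eqE -mulnb natrM !mxE.
  by rewrite ![_ == 0 :> 'I_1](introT eqP (ord1 _)) !andbT.
apply/matrixP=> k l; rewrite /msc_mul summxE mxE.
rewrite (bigD1 (mxtens_index (i, j))) //= [X in _ + X]big1 ?addr0; last first.
  by move=> m ne_m; rewrite tE (negPf ne_m) mulr0.
rewrite (bigD1 k) //= [X in _ = _ + X]big1 ?addr0.
  by rewrite tE !mxE !eqxx ord1 eqxx.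
by move=> m ne_mk; rewrite !mxE eq_sym (negPf ne_mk) mulr0.
Qed.

Lemma msc_mul_bilinear (A : 'M[R]_(2, 2 * 2)) :
  bilinear_for *:%R *:%R (msc_mul A).
Proof.
split=> w a u v; rewrite /= /msc_mul.
- have -> : (a *: u + v) *t w = a *: (u *t w) + v *t w.
    by apply/matrixP=> i j; rewrite !mxE mulrDl mulrA.
  by rewrite mulmxDr -scalemxAr.
- have -> : w *t (a *: u + v) = a *: (w *t u) + w *t v.
    by apply/matrixP=> i j; rewrite !mxE mulrDr mulrCA.
  by rewrite mulmxDr -scalemxAr.
Qed.

Lemma msc_isomorphicP (A B : 'M[R]_(2, 2 * 2)) :
  algebra_isomorphic (msc_mul A) (msc_mul B) <->
  exists2 g : 'M[R]_2, g \in unitmx & B = g *m A *m (invmx g *t invmx g).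
Proof.
have mxP (M N : 'M[R]_(2, 2 * 2)) :
  (forall u v : 'cV[R]_2, M *m (u *t v) = N *m (u *t v)) -> M = N.
  move=> eqMN; apply/matrixP=> k m; case: (mxtens_indexP m) => i j.
  have /matrixP/(_ k 0) := eqMN (delta_mx i 0) (delta_mx j 0).
  rewrite -!/(msc_mul _ _ _) !msc_mul_delta !summxE (bigD1 k) //=.
  rewrite [in RHS](bigD1 k) //= !big1 ?addr0; last first.
  - by move=> l nel; rewrite !mxE eq_sym (negPf nel) mulr0.
  - by move=> l nel; rewrite !mxE eq_sym (negPf nel) mulr0.
  by rewrite !mxE !eqxx !mulr1.
split=> [[f [[f' fK f'K] fM]]|[g g_unit ->]].
- pose mxf (h : 'cV[R]_2 -> 'cV[R]_2) := \matrix_(i, j) h (delta_mx j 0) i 0.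
  have fE u : f u = mxf f *m u.
    rewrite {1}[u]matrix_sum_delta linear_sum; apply/matrixP=> i j.
    rewrite ord1 summxE mxE; apply: eq_bigr => k _.
    by rewrite big_ord1 linearZ !mxE mulrC.
  have g_unit : mxf f \in unitmx.
    suff /mulmx1_unit[] : mxf f *m mxf f' = 1%:M by [].
    apply/matrixP=> i j; have /matrixP/(_ i 0) := f'K (delta_mx j 0).
    rewrite fE !mxE andbT => <-; apply: eq_bigr => k _; by rewrite !mxE.
  exists (mxf f) => //.
  have eqBA : B *m (mxf f *t mxf f) = mxf f *m A.
    apply: mxP => u v; rewrite -!mulmxA tensmx_mul.
    by have := fM u v; rewrite !fE.
  rewrite -eqBA -mulmxA tensmx_mul mulmxV //.
  suff -> : (1%:M : 'M[R]_2) *t (1%:M : 'M[R]_2) = 1%:M by rewrite mulmx1.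
  apply/matrixP=> m n; rewrite !mxE -natrM mulnb -xpair_eqE -!surjective_pairing.
  by rewrite (can_eq (@mxtens_unindexK 2 2)).
- exists (mulmx g); split.
    by exists (mulmx (invmx g)) => u; rewrite /= mulmxA (mulVmx, mulmxV) ?mul1mx.
  move=> u v; rewrite /msc_mul /= -!mulmxA tensmx_mul.
  by rewrite !mulmxA mulVmx // !mul1mx.
Qed.

Definition msc (a b c d a' b' c' d' : R) : 'M[R]_(2, 2 * 2) :=
  \matrix_(k < 2, l < 2 * 2)
    nth 0 (nth [::] [:: [:: a; b; c; d]; [:: a'; b'; c'; d']] k) l.

Definition jordan_list : 6.-tuple 'M[R]_(2, 2 * 2) :=
  [tuple
    msc (1 / 2) 0       0       1
        0       (1 / 2) (1 / 2) 0;
    msc (1 / 2) 0       0       (-1)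
        0       (1 / 2) (1 / 2) 0;
    msc (2 / 3) 0       0       0
        0       (1 / 3) (1 / 3) 0;
    msc (1 / 2) 0       0       0
        0       (1 / 2) (1 / 2) 0;
    msc 1       0       0       0
        0       0       0       0;
    msc 0       0       0       0
        1       0       0       0].

End Algebras.

(* Main.v *)
From HB Require Import structures.
Require Import Defs.
From mathcomp Require Import all_boot all_order all_algebra.
From mathcomp Require Import reals boolp ring lra.

Set Implicit Arguments.
Unset Strict Implicit.
Unset Printing Implicit Defensive.

Import Order.TTheory GRing.Theory Num.Theory.
Local Open Scope ring_scope.

(** Existence. If some u is linearly independent of u^2, write
    u.u^2 = p u + q u^2; the Jordan identity at (u, u) gives
    u^2.u^2 = u.(u.u^2), so the algebra is X R[X] / (X^3 - q X^2 - p X). It is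
    unital iff p != 0, and then the sign of p + q^2/4 separates R x R, C and the
    dual numbers. Otherwise every u^2 is a multiple of u, which forces
    2 u.v = phi(v) u + phi(u) v for a nonzero linear form phi.

    Uniqueness. The Peirce spectrum, i.e. the set of eigenvalues of the
    multiplications by nonzero idempotents, together with the existence of a
    nonzero element of square zero, tells the six algebras apart. *)

(** * Coordinate vectors of the plane *)

Definition col2 (K : fieldType) (a b : K) : 'cV[K]_2 :=
  \col_i (if i == 0 then a else b).

Lemma col2_eta (K : fieldType) (u : 'cV[K]_2) : u = col2 (u 0 0) (u 1 0).
Proof.
apply/matrixP => -[[|[|//]] ?] j; rewrite mxE ord1; congr (u _ 0);
  exact: val_inj.
Qed.

Lemma col2_inj (K : fieldType) (a b c d : K) :
  col2 a b = col2 c d -> a = c /\ b = d.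
Proof.
by move=> /matrixP e; split; [have := e 0 0|have := e 1 0]; rewrite !mxE.
Qed.

Lemma col2_0 (K : fieldType) : 0 = col2 0 0 :> 'cV[K]_2.
Proof. by apply/matrixP => i j; rewrite !mxE if_same. Qed.

Lemma col2_neq0 (K : fieldType) (a b : K) :
  (col2 a b != 0) = (a != 0) || (b != 0).
Proof.
rewrite col2_0.
apply/idP/idP; last by move=> /orP[]; apply: contra_neq => /col2_inj[].
by rewrite -negb_and; apply: contra => /andP[/eqP-> /eqP->].
Qed.

Lemma col2_scale (K : fieldType) (k a b : K) :
  k *: col2 a b = col2 (k * a) (k * b).
Proof. by apply/matrixP => i j; rewrite !mxE; case: eqP. Qed.

Lemma msc_mul_col2 (K : fieldType) (a b c d a' b' c' d' x y z t : K) :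
  msc_mul (msc a b c d a' b' c' d') (col2 x y) (col2 z t) =
  col2 (a * (x * z) + b * (x * t) + c * (y * z) + d * (y * t))
       (a' * (x * z) + b' * (x * t) + c' * (y * z) + d' * (y * t)).
Proof.
rewrite [LHS]col2_eta; congr col2; rewrite mxE !big_ord_recl big_ord0 !mxE /=;
  by rewrite !addrA addr0.
Qed.

(** * Commutative plane algebras and changes of basis *)

Section Plane.
Variables (K : fieldType) (V : vectType K) (mul : {bilinear V -> V -> V}).
Hypothesis dimV : \dim {:V} = 2%N.
Hypothesis mulC : forall u v, mul u v = mul v u.

Lemma free2P (x y : V) :
  reflect (forall a b, a *: x + b *: y = 0 -> a = 0 /\ b = 0)
          (free [:: x; y]).
Proof.
apply: (@iffP _ _ _ (@freeP _ _ _ [tuple x; y])) => xy.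
  move=> a b ab0; have := xy (fun i => if i == 0 then a else b).
  rewrite !big_ord_recl big_ord0 /= addr0 => /(_ ab0) k.
  by split; [have := k 0|have := k 1].
move=> k; rewrite !big_ord_recl big_ord0 /= addr0 => /xy[k0 k1].
case=> [[|[|//]] i]; first by rewrite -[RHS]k0; congr k; apply: val_inj.
by rewrite -[RHS]k1; congr k; apply: val_inj.
Qed.

Lemma free2_inj (x y : V) (a b c d : K) :
  free [:: x; y] -> a *: x + b *: y = c *: x + d *: y -> a = c /\ b = d.
Proof.
move=> /free2P fxy /eqP; rewrite -subr_eq0 opprD addrACA -!scalerBl.
by move=> /eqP/fxy[/eqP + /eqP]; rewrite !subr_eq0 => /eqP-> /eqP->.
Qed.

Lemma free2_gen (x y u : V) :
  free [:: x; y] -> exists a b, u = a *: x + b *: y.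
Proof.
move=> fxy; have : basis_of {:V} [tuple x; y].
  by rewrite basisEfree fxy subvf dimV.
move=> /coord_basis /(_ (memvf u)) ->.
by rewrite !big_ord_recl big_ord0 addr0 /=; do 2!eexists.
Qed.

Let lcD (x y : V) (p q r s : K) :
  (p *: x + q *: y) + (r *: x + s *: y) = (p + r) *: x + (q + s) *: y.
Proof. by rewrite addrACA -!scalerDl. Qed.

Let lcZ (x y : V) (k p q : K) :
  k *: (p *: x + q *: y) = (k * p) *: x + (k * q) *: y.
Proof. by rewrite scalerDr !scalerA. Qed.

Lemma mul_lc (x y : V) (a b c a' b' c' p q r s : K) :
  mul x x = a *: x + a' *: y -> mul x y = b *: x + b' *: y ->
  mul y y = c *: x + c' *: y ->
  mul (p *: x + q *: y) (r *: x + s *: y) =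
  (a * (p * r) + b * (p * s + q * r) + c * (q * s)) *: x +
  (a' * (p * r) + b' * (p * s + q * r) + c' * (q * s)) *: y.
Proof.
move=> xx xy yy.
rewrite linearDr /= !linearZr_LR /= !linearDl /= !linearZl_LR /= (mulC y x).
rewrite xx xy yy !lcZ !lcD.
by congr (_ *: _ + _ *: _); ring.
Qed.

(** The isomorphism is the coordinate map of the basis [x], [y]; commutativity repeats [b] and [b']
    in the two middle columns. *)
Lemma isomorphic_msc (x y : V) (a b c a' b' c' : K) :
  free [:: x; y] ->
  mul x x = a *: x + a' *: y -> mul x y = b *: x + b' *: y ->
  mul y y = c *: x + c' *: y ->
  algebra_isomorphic mul (msc_mul (msc a b b c a' b' b' c')).
Proof.
move=> fxy xx xy yy; pose X := [tuple x; y].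
pose f (u : V) := col2 (coord X 0 u) (coord X 1 u).
have f_lin : linear f.
  move=> k u v; rewrite /f !linearP /=.
  by apply/matrixP => i j; rewrite !mxE; case: eqP.
pose F : {linear V -> 'cV[K]_2} :=
  HB.pack f (GRing.isLinear.Build _ _ _ _ f f_lin).
have fE p q : f (p *: x + q *: y) = col2 p q.
  pose k (i : 'I_2) := if i == 0 then p else q.
  have cE j : coord X j (p *: x + q *: y) = k j.
    rewrite -(coord_sum_free k j (fxy : free X)).
    by rewrite !big_ord_recl big_ord0 addr0.
  by rewrite /f !cE.
exists F; split.
  exists (fun w : 'cV[K]_2 => w 0 0 *: x + w 1 0 *: y).
    by move=> u; have [p [q ->]] := free2_gen u fxy; rewrite /= fE !mxE.
  by move=> w; rewrite /= fE -col2_eta.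
move=> u v; have [p [q ->]] := free2_gen u fxy.
have [r [s ->]] := free2_gen v fxy.
by rewrite (mul_lc _ _ _ _ xx xy yy) /= !fE msc_mul_col2; congr col2; ring.
Qed.

(** The new basis is [p *: x + q *: y], [r *: x + s *: y], and the six equations compare coordinates
    of its three products in the old basis. Once a basis is proposed, only scalar identities
    remain. *)
Lemma isomorphic_msc_basis (x y : V) (a b c a' b' c' : K)
    (p q r s A B C A' B' C' : K) :
  free [:: x; y] ->
  mul x x = a *: x + a' *: y -> mul x y = b *: x + b' *: y ->
  mul y y = c *: x + c' *: y ->
  p * s - q * r != 0 ->
  a * (p * p) + b * (p * q + q * p) + c * (q * q) = A * p + A' * r ->
  a' * (p * p) + b' * (p * q + q * p) + c' * (q * q) = A * q + A' * s ->
  a * (p * r) + b * (p * s + q * r) + c * (q * s) = B * p + B' * r ->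
  a' * (p * r) + b' * (p * s + q * r) + c' * (q * s) = B * q + B' * s ->
  a * (r * r) + b * (r * s + s * r) + c * (s * s) = C * p + C' * r ->
  a' * (r * r) + b' * (r * s + s * r) + c' * (s * s) = C * q + C' * s ->
  algebra_isomorphic mul (msc_mul (msc A B B C A' B' B' C')).
Proof.
move=> fxy xx xy yy det e1 e2 e3 e4 e5 e6.
apply: (@isomorphic_msc (p *: x + q *: y) (r *: x + s *: y));
  rewrite ?(mul_lc _ _ _ _ xx xy yy) ?lcZ ?lcD; try by congr (_ *: _ + _ *: _).
apply/free2P => k l; rewrite !lcZ lcD => /(free2P _ _ fxy)[h1 h2].
(* Cramer's rule: the determinant times each coefficient is a combination of two vanishing
   coordinates. *)
have k0 : k * (p * s - q * r) =
    (k * p + l * r) * s - (k * q + l * s) * r by ring.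
have l0 : l * (p * s - q * r) =
    (k * q + l * s) * p - (k * p + l * r) * q by ring.
move: k0 l0; rewrite h1 h2 !mul0r subrr => /eqP + /eqP.
by rewrite !mulf_eq0 (negPf det) !orbF => /eqP-> /eqP->.
Qed.

End Plane.

(** [n] may equal [e], so the value 1 belongs to the spectrum exactly when a nonzero idempotent
    exists. *)
Definition peirce (K : fieldType) (V : lmodType K) (mul : V -> V -> V)
    (l : K) :=
  exists e n, [/\ e != 0, n != 0, mul e e = e & mul e n = l *: n].

Definition square_zero (K : fieldType) (V : lmodType K) (mul : V -> V -> V) :=
  exists2 n, n != 0 & mul n n = 0.

(** * Invariance under isomorphism *)

Section Invariance.
Variables (K : fieldType) (V W : lmodType K).
Variables (mulV : V -> V -> V) (mulW : W -> W -> W).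
Hypothesis iso : algebra_isomorphic mulV mulW.

Lemma peirce_isomorphic l : peirce mulV l <-> peirce mulW l.
Proof.
have [f [[g fK gK] fM]] := iso; have f_inj := can_inj fK.
have f_neq0 u : (f u != 0) = (u != 0) by rewrite -(inj_eq f_inj) linear0.
split=> [[e [n [e0 n0 ee en]]]|[e [n []]]].
  by exists (f e), (f n); rewrite !f_neq0 -!fM ee en linearZ.
rewrite -[e]gK -[n]gK !f_neq0 -!fM -linearZ /= => e0 n0 /f_inj ee /f_inj en.
by exists (g e), (g n).
Qed.

Lemma square_zero_isomorphic : square_zero mulV <-> square_zero mulW.
Proof.
have [f [[g fK gK] fM]] := iso; have f_inj := can_inj fK.
have f_neq0 u : (f u != 0) = (u != 0) by rewrite -(inj_eq f_inj) linear0.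
split=> [[n n0 nn]|[n]].
  by exists (f n); rewrite ?f_neq0 // -fM nn linear0.
rewrite -[n]gK f_neq0 -fM => n0 nn; exists (g n) => //.
by apply: f_inj; rewrite nn linear0.
Qed.

End Invariance.

(** * Invariants of the six listed algebras *)

Section JordanList.
Variable R : realType.
Local Notation M i := (msc_mul (tnth (jordan_list R) i)).

Lemma peirceP (a b c d a' b' c' d' l : R) :
  peirce (msc_mul (msc a b c d a' b' c' d')) l <->
  exists p q r s : R, [/\ (p != 0) || (q != 0), (r != 0) || (s != 0),
   a * (p * p) + b * (p * q) + c * (q * p) + d * (q * q) = p /\
   a' * (p * p) + b' * (p * q) + c' * (q * p) + d' * (q * q) = q &
   a * (p * r) + b * (p * s) + c * (q * r) + d * (q * s) = l * r /\
   a' * (p * r) + b' * (p * s) + c' * (q * r) + d' * (q * s) = l * s].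
Proof.
split=> [[e [n []]]|[p [q [r [s [e0 n0 [e1 e2] [n1 n2]]]]]]].
  rewrite [e]col2_eta [n]col2_eta !col2_neq0 !msc_mul_col2 col2_scale.
  move=> e0 n0 /col2_inj e_idem /col2_inj en.
  by exists (e 0 0), (e 1 0), (n 0 0), (n 1 0).
exists (col2 p q), (col2 r s).
by rewrite !col2_neq0 !msc_mul_col2 col2_scale e1 e2 n1 n2.
Qed.

Lemma square_zeroP (a b c d a' b' c' d' : R) :
  square_zero (msc_mul (msc a b c d a' b' c' d')) <->
  exists r s : R, [/\ (r != 0) || (s != 0),
   a * (r * r) + b * (r * s) + c * (s * r) + d * (s * s) = 0 &
   a' * (r * r) + b' * (r * s) + c' * (s * r) + d' * (s * s) = 0].
Proof.
split=> [[n]|[r [s [n0 e1 e2]]]].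
  rewrite [n]col2_eta col2_neq0 !msc_mul_col2 col2_0 => n0 /col2_inj[e1 e2].
  by exists (n 0 0), (n 1 0).
by exists (col2 r s); rewrite ?col2_neq0 // !msc_mul_col2 e1 e2 -col2_0.
Qed.

Lemma mulf_eq0_or (x y : R) : x * y = 0 -> x = 0 \/ y = 0.
Proof. by move=> /eqP; rewrite mulf_eq0 => /orP[]/eqP; [left|right]. Qed.

(** Pins down eigenvalues: [k] will be a polynomial in [l] that kills both coordinates of an
    eigenvector. *)
Lemma common_factor_eq0 (k r s : R) :
  (r != 0) || (s != 0) -> k * r = 0 -> k * s = 0 -> k = 0.
Proof.
move=> rs /mulf_eq0_or[//|r0] /mulf_eq0_or[//|s0].
by rewrite r0 s0 eqxx in rs.
Qed.

(** In each case the idempotents [(p, q)] are found first; the eigenvector [(r, s)] is then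
    eliminated to leave a polynomial equation in [l]. *)
Lemma peirce_jordan_list (i : 'I_6) (l : R) :
  peirce (M i) l <->
  l \in nth [::]
    [:: [:: 0; 1]; [:: 1]; [:: 1 / 2; 1]; [:: 1]; [:: 0; 1]; [::]] i.
Proof.
have n2 : 2 != 0 :> R by rewrite pnatr_eq0.
have n1 : 1 != 0 :> R by rewrite oner_eq0.
have n32 : 3 / 2 != 0 :> R by apply/eqP; lra.
case: i => [[|[|[|[|[|[|//]]]]]] ?];
  rewrite (tnth_nth 0) /= peirceP ?inE ?in_nil;
  split=> [[p [q [r [s [pq rs [e1 e2] [f1 f2]]]]]]|].
- have [q0|p1] : q = 0 \/ p - 1 = 0 by apply: mulf_eq0_or; lra.
    rewrite q0 eqxx orbF in pq.
    have [p0|p2] : p = 0 \/ p - 2 = 0.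
        by apply: mulf_eq0_or; rewrite q0 in e1; lra.
      by rewrite p0 eqxx in pq.
    (* [(2, 0)] is the unit, so its only eigenvalue is 1. *)
    have {}p2 : p = 2 by lra.
    rewrite q0 p2 in f1 f2.
    rewrite -[l == 1]subr_eq0; apply/orP; right.
    by apply/eqP/(common_factor_eq0 rs); lra.
  have {}p1 : p = 1 by lra.
  rewrite p1 in e1 f1 f2.
  (* Here [(l - 1 / 2) * r = q * s] and [(l - 1 / 2) * s = q * r / 2] with [q * q = 1 / 2]. The
     products supply the monomials from which [lra] derives [l * (l - 1) * r = 0], and the same for
     [s]. *)
  have := congr1 (fun t => (l - 1 / 2) * t) f1 => /= ?.
  have := congr1 (fun t => (l - 1 / 2) * t) f2 => /= ?.
  have := congr1 (fun t => q * t) f1 => /= ?.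
  have := congr1 (fun t => q * t) f2 => /= ?.
  have := congr1 (fun t => r * t) e1 => /= ?.
  have := congr1 (fun t => s * t) e1 => /= ?.
  rewrite -[l == 1]subr_eq0 -mulf_eq0.
  by apply/eqP/(common_factor_eq0 rs); lra.
- case/orP=> /eqP->; last first.
    by exists 2, 0, 2, 0; rewrite n2; split=> //; split; field.
  (* For this [t] the idempotents [(1, t)] and [(1, - t)] are orthogonal, which realizes the
     eigenvalue 0. *)
  have [t t2] : exists t : R, t * t = 1 / 2.
    by exists (Num.sqrt (1 / 2)); rewrite -expr2 sqr_sqrtr //; lra.
  by exists 1, t, 1, (- t); rewrite n1; split=> //; split; lra.
- have [q0|p1] : q = 0 \/ p - 1 = 0 by apply: mulf_eq0_or; lra.
    rewrite q0 eqxx orbF in pq.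
    have [p0|p2] : p = 0 \/ p - 2 = 0.
        by apply: mulf_eq0_or; rewrite q0 in e1; lra.
      by rewrite p0 eqxx in pq.
    have {}p2 : p = 2 by lra.
    rewrite q0 p2 in f1 f2.
    by rewrite -subr_eq0; apply/eqP/(common_factor_eq0 rs); lra.
  (* This branch would need [q * q = - 1 / 2]. *)
  have {}p1 : p = 1 by lra.
  by rewrite p1 in e1; have := sqr_ge0 q; rewrite expr2; lra.
- by move=> /eqP->; exists 2, 0, 2, 0; rewrite n2; split=> //; split; field.
- have [p0|p2] : p = 0 \/ p - 3 / 2 = 0 by apply: mulf_eq0_or; lra.
    have q0 : q = 0 by rewrite p0 in e2; lra.
    by rewrite p0 q0 eqxx in pq.
  have {}p2 : p = 3 / 2 by lra.
  rewrite p2 in f1 f2.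
  (* Every [(3 / 2, q)] is idempotent, and its multiplication is triangular with diagonal 1, 1/2. *)
  have := congr1 (fun t => (l - 1 / 2) * t) f1 => /= ?.
  have := congr1 (fun t => (l - 1) * t) f2 => /= ?.
  have := congr1 (fun t => q * t) f1 => /= ?.
  rewrite -[l == 1]subr_eq0 -[l == 1 / 2]subr_eq0 -mulf_eq0.
  by apply/eqP/(common_factor_eq0 rs); lra.
- case/orP=> /eqP->.
    by exists (3 / 2), 0, 0, 1; rewrite n1 n32 orbT; split=> //; split; field.
  by exists (3 / 2), 0, (3 / 2), 0; rewrite n32; split=> //; split; field.
- have [p0|p2] : p = 0 \/ p - 2 = 0 by apply: mulf_eq0_or; lra.
    have q0 : q = 0 by rewrite p0 in e2; lra.
    by rewrite p0 q0 eqxx in pq.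
  have {}p2 : p = 2 by lra.
  have q0 : q = 0 by rewrite p2 in e2; lra.
  rewrite q0 p2 in f1 f2.
  by rewrite -subr_eq0; apply/eqP/(common_factor_eq0 rs); lra.
- by move=> /eqP->; exists 2, 0, 2, 0; rewrite n2; split=> //; split; field.
- have q0 : q = 0 by lra.
  rewrite q0 eqxx orbF in pq.
  have [p0|p1] : p = 0 \/ p - 1 = 0 by apply: mulf_eq0_or; lra.
    by rewrite p0 eqxx in pq.
  have {}p1 : p = 1 by lra.
  rewrite q0 p1 in f1 f2.
  have := congr1 (fun t => l * t) f1 => /= ?.
  have := congr1 (fun t => l * t) f2 => /= ?.
  rewrite -[l == 1]subr_eq0 -mulf_eq0.
  by apply/eqP/(common_factor_eq0 rs); lra.
- case/orP=> /eqP->.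
    by exists 1, 0, 0, 1; rewrite n1 orbT; split=> //; split; field.
  by exists 1, 0, 1, 0; rewrite n1; split=> //; split; field.
- have p0 : p = 0 by lra.
  have q0 : q = 0 by rewrite p0 in e2; lra.
  by rewrite p0 q0 eqxx in pq.
- by [].
Qed.

(** Separates the algebras with equal spectra: index 0 from 4, and 1 from 3. From index 2 on, the
    second basis vector squares to zero. *)
Lemma square_zero_jordan_list (i : 'I_6) : square_zero (M i) <-> (2 <= i)%N.
Proof.
case: i => [[|[|[|[|[|[|//]]]]]] ?]; rewrite (tnth_nth 0) /= square_zeroP;
  split=> //;
  try by move=> _; exists 0, 1; rewrite oner_eq0 orbT; split=> //; field.
all: case=> [r [s [rs e1 e2]]].
all: have [r0|s0] : r = 0 \/ s = 0 by apply: mulf_eq0_or; lra.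
all: suff [r0' s0'] : r = 0 /\ s = 0 by rewrite r0' s0' eqxx in rs.
all: split=> //.
all: apply/eqP; rewrite -sqrf_eq0 expr2; apply/eqP.
all: by rewrite ?r0 ?s0 in e1; lra.
Qed.

Lemma jordan_list_inj (V : lmodType R) (mul : V -> V -> V) (i j : 'I_6) :
  algebra_isomorphic mul (M i) -> algebra_isomorphic mul (M j) -> i = j.
Proof.
move=> Ii Ij.
have P l := iff_trans (iff_sym (peirce_isomorphic Ii l))
              (peirce_isomorphic Ij l).
have {P}P l := iff_trans (iff_sym (peirce_jordan_list i l))
                 (iff_trans (P l) (peirce_jordan_list j l)).
have Z := iff_trans (iff_sym (square_zero_isomorphic Ii))
            (square_zero_isomorphic Ij).
have {}Z := iff_trans (iff_sym (square_zero_jordan_list i))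
              (iff_trans Z (square_zero_jordan_list j)).
have h0 : (0 == 1 / 2 :> R) = false by apply/eqP; lra.
have h1 : (1 / 2 == 0 :> R) = false by rewrite eq_sym.
have h2 : (1 / 2 == 1 :> R) = false by apply/eqP; lra.
have h3 : (1 == 1 / 2 :> R) = false by rewrite eq_sym.
have h4 : (0 == 1 :> R) = false by rewrite eq_sym oner_eq0.
(* All spectra lie in {0, 1/2, 1}, so testing these three values loses nothing. *)
have := P 0; have := P (1 / 2); have {P} := P 1; move: Z {Ii Ij}.
case: i => [[|[|[|[|[|[|//]]]]]] ?]; case: j => [[|[|[|[|[|[|//]]]]]] ?];
  rewrite /= ?inE ?h0 ?h1 ?h2 ?h3 ?h4 ?oner_eq0 ?eqxx ?in_nil /= => *;
  try exact: val_inj; exfalso; intuition.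
Qed.

End JordanList.

(** * Existence of an isomorphism with a listed algebra *)

Section Classification.
Variables (R : realType) (V : vectType R) (mul : {bilinear V -> V -> V}).
Hypothesis dimV : \dim {:V} = 2%N.
Local Notation classified :=
  (exists i : 'I_6, algebra_isomorphic mul (msc_mul (tnth (jordan_list R) i))).

Lemma classify_associative (u : V) :
  commutative_jordan mul -> free [:: u; mul u u] -> classified.
Proof.
move=> [mulC jordan] fuw; set w := mul u u in fuw.
have [p [q uw]] := free2_gen dimV (mul u w) fuw.
have uu : mul u u = 0 *: u + 1 *: w by rewrite scale0r scale1r add0r.
have ww : mul w w = (q * p) *: u + (p + q * q) *: w.
  rewrite {1 2}/w jordan -/w uw linearDr /= !linearZr_LR /= uw -/w.
  by rewrite scalerDr !scalerA addrCA scalerDl.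
have iso := isomorphic_msc_basis dimV mulC fuw uu uw ww.
have [p0|p0] := eqVneq p 0.
  have [q0|q0] := eqVneq q 0.
    exists (inord 5); rewrite (tnth_nth 0) inordK //=.
    by apply: (iso 1 0 0 1); rewrite ?p0 ?q0; try ring; apply/eqP; lra.
  (* The idempotent w / q^2 annihilates u - w / q. *)
  exists (inord 4); rewrite (tnth_nth 0) inordK //=.
  apply: (iso 0 (1 / (q * q)) 1 (- 1 / q)); rewrite ?p0; try field => //.
  by rewrite mul0r sub0r oppr_eq0 mulr1 mul1r invr_eq0 mulf_neq0.
(* Completing the square in [w = q *: u + p *: e], with [e] the unit, gives [u - (q / 2) *: e] the
   square [(p + q * q / 4) *: e]. The factor 2 in [c] appears because [e / 2] is the basis vector;
   [t] serves to scale [c] to 1, -1 or 0. *)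
have unital c t : t != 0 -> c = 2 * (p + q * q / 4) / (t * t) ->
    algebra_isomorphic mul (msc_mul (msc (1 / 2) 0 0 c 0 (1 / 2) (1 / 2) 0)).
  (* The unit is e = (w - q u) / p; the new basis is e / 2, (u - q e / 2) / t. *)
  move=> t0 ->.
  apply: (iso (- q / (2 * p)) (1 / (2 * p)) ((1 + q * q / (2 * p)) / t)
              (- q / (2 * p) / t)); try by field; rewrite ?t0.
  have -> : - q / (2 * p) * (- q / (2 * p) / t) -
      1 / (2 * p) * ((1 + q * q / (2 * p)) / t) = - (2 * p * t)^-1.
    by field; rewrite t0.
  by rewrite oppr_eq0 invr_eq0 !mulf_neq0 // pnatr_eq0.
have rt x : 0 < x -> exists2 t : R, t != 0 & x = t * t.
  move=> x0; exists (Num.sqrt x); first by rewrite gt_eqF ?sqrtr_gt0.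
  by rewrite -expr2 sqr_sqrtr // ltW.
have [D0|D0|D0] := ltrgt0P (2 * (p + q * q / 4)).
- exists (inord 0); rewrite (tnth_nth 0) inordK //=.
  have [t t0 tE] := rt _ D0; apply: (unital _ t) => //.
  by rewrite -tE divff ?gt_eqF.
- exists (inord 1); rewrite (tnth_nth 0) inordK //=.
  rewrite -oppr_gt0 in D0; have [t t0 tE] := rt _ D0; apply: (unital _ t) => //.
  by rewrite -tE invrN mulrN divff // -oppr_eq0 gt_eqF.
- exists (inord 3); rewrite (tnth_nth 0) inordK //=.
  by apply: (unital _ 1); rewrite ?oner_eq0 // D0 mul0r.
Qed.

Lemma classify_no_square_basis :
  nontrivial_algebra mul -> (forall u v, mul u v = mul v u) ->
  (forall u, ~~ free [:: u; mul u u]) -> classified.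
Proof.
move=> [u0 [v0 uv0]] mulC nfree.
have sq u : exists k, mul u u = k *: u.
  have [->|u0'] := eqVneq u 0; first by exists 0; rewrite linear0r scaler0.
  (* [free_cons] tests the head against the span of the tail, so the square has to come first. *)
  have /perm_free fE : perm_eq [:: u; mul u u] [:: mul u u; u].
    by rewrite (perm_catC [:: u] [:: mul u u]).
  have := nfree u; rewrite fE free_cons seq1_free u0' andbT negbK span_seq1.
  by move=> /vlineP.
have [x [y fxy]] : exists x y : V, free [:: x; y].
  have := vbasisP {:V}; case: (vbasis _) => s /= ss /basis_free.
  by move: ss; rewrite dimV; case: s => [|x [|y [|//]]] // _; exists x, y.
have [a xx] := sq x; have [b yy] := sq y.
have [b1 [b2 xy]] := free2_gen dimV (mul x y) fxy.
have {}xx : mul x x = a *: x + 0 *: y by rewrite scale0r addr0.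
have {}yy : mul y y = 0 *: x + b *: y by rewrite scale0r add0r.
have mE := mul_lc mulC _ _ _ _ xx xy yy.
have {}sq r s : exists k,
    a * (r * r) + b1 * (r * s + s * r) + 0 * (s * s) = k * r /\
    0 * (r * r) + b2 * (r * s + s * r) + b * (s * s) = k * s.
  have [k] := sq (r *: x + s *: y); rewrite mE scalerDr !scalerA.
  by move=> /(free2_inj fxy); exists k.
(* Polarization: the squares of [x + y] and [x - y] are multiples of these vectors, which forces
   [mul x y] to be half of [b *: x + a *: y]. Thus phi takes the values [a] at [x] and [b] at
   [y]. *)
have [c [c1 c2]] := sq 1 1; have [d [d1 d2]] := sq 1 (-1).
have b1E : b1 = b / 2 by clear -c1 c2 d1 d2; lra.
have b2E : b2 = a / 2 by clear -c1 c2 d1 d2; lra.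
have iso := isomorphic_msc_basis dimV mulC fxy xx xy yy.
(* b x - a y spans the kernel of the linear form phi. *)
exists (inord 2); rewrite (tnth_nth 0) inordK //=.
have [a0|a0] := eqVneq a 0; last first.
  (* The multiple of [x] is chosen with phi equal to 2/3: its square is 2/3 of itself, and it acts
     on the kernel of phi as 1/3. If [a] vanishes, [y] replaces [x]. *)
  apply: (iso (2 / (3 * a)) 0 b (- a)); rewrite ?b1E ?b2E; try by field.
  have -> : 2 / (3 * a) * - a - 0 * b = - (2 / 3) by field.
  by rewrite oppr_eq0 mulf_neq0 ?invr_eq0 ?pnatr_eq0.
have [b0|b0] := eqVneq b 0; last first.
  apply: (iso 0 (2 / (3 * b)) b (- a)); rewrite ?b1E ?b2E ?a0; try by field.
  have -> : 0 * - 0 - 2 / (3 * b) * b = - (2 / 3) by field.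
  by rewrite oppr_eq0 mulf_neq0 ?invr_eq0 ?pnatr_eq0.
(* With phi zero the whole product vanishes. *)
case/eqP: uv0; have [r [s ->]] := free2_gen dimV u0 fxy.
have [r' [s' ->]] := free2_gen dimV v0 fxy.
by rewrite mE b1E b2E a0 b0 !mul0r !addr0 !scale0r addr0.
Qed.

End Classification.

Theorem theorem2p6 (R : realType) (V : vectType R) (mul : {bilinear V -> V -> V}) :
  \dim {:V} = 2%N ->
  nontrivial_algebra mul ->
  commutative_jordan mul ->
  exists! i : 'I_6, algebra_isomorphic mul (msc_mul (tnth (jordan_list R) i)).
Proof.
move=> dimV nontriv jordan; have [mulC _] := jordan.
suff [i iso_i] : exists i : 'I_6,
    algebra_isomorphic mul (msc_mul (tnth (jordan_list R) i)).
  by exists i; split=> // j; apply: jordan_list_inj.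
have [[u fu]|nfree] := pselect (exists u, free [:: u; mul u u]).
  exact: classify_associative fu.
apply: classify_no_square_basis => // u; apply/negP => fu.
by apply: nfree; exists u.
Qed.
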